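(* Let $A=\mathrm{IDD}(K^1_6,-1,-1)$ be the complex algebra with basis $e_1,\ldots,e_6$ and bilinear multiplication $e_i\diamond e_j=\frac{1}{(i+1)(j+1)}e_{i+j+2}$ if $i+j\le 4$, and $e_i\diamond e_j=0$ otherwise. Then the space of derivations of $A$ is $$\mathfrak{Der}(A)=\langle\varphi_i,\ \phi_j,\ \psi_k : 1\le i\le 6,\ 2\le j\le 6,\ 4\le k\le 6\rangle,$$ where these linear maps are given on the basis (all values not listed being zero) by - $\varphi_6(e_1)=e_6$; $\ \varphi_5(e_1)=e_5$; $\ \varphi_4(e_1)=e_4$; - $\varphi_3(e_1)=e_3$, $\varphi_3(e_4)=e_6$; - $\varphi_2(e_1)=3e_2$, $\varphi_2(e_4)=4e_5$, $\varphi_2(e_5)=2e_6$; - $\varphi_1(e_1)=e_1$, $\varphi_1(e_3)=-e_3$, $\varphi_1(e_4)=2e_4$, $\varphi_1(e_5)=e_5$; - $\phi_6(e_2)=e_6$; $\ \phi_5(e_2)=e_5$; $\ \phi_4(e_2)=e_4$; - $\phi_3(e_2)=4e_3$, $\phi_3(e_5)=3e_6$; - $\phi_2(e_2)=e_2$, $\phi_2(e_3)=2e_3$, $\phi_2(e_5)=e_5$, $\phi_2(e_6)=2e_6$; - $\psi_6(e_3)=e_6$; $\ \psi_5(e_3)=e_5$; $\ \psi_4(e_3)=e_4$.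
   Context: A derivation of an algebra $(A,\diamond)$ is a linear map $D:A\to A$ with $D(a\diamond b)=D(a)\diamond b+a\diamond D(b)$ for all $a,b\in A$. $\langle S\rangle$ denotes the linear span of $S$ over $\mathbb C$. *)

(* Defs.v *)
From HB Require Import structures.
From mathcomp Require Import all_boot all_order all_algebra.
From mathcomp Require Import reals complex.

Set Implicit Arguments.
Unset Strict Implicit.
Unset Printing Implicit Defensive.

Import GRing.Theory.

Local Open Scope ring_scope.

Definition is_derivation (K : fieldType) (V : vectType K) (mul : V -> V -> V)
    (D : 'End(V)) : Prop :=
  forall a b : V, D (mul a b) = mul (D a) b + mul a (D b).

(* The underlying space of IDD(K^1_6, -1, -1). Row coordinates are numbered
   from 0, so the coefficient of e_(j+1) in a is [a 0 j]. *)
Notation IDD R := 'rV[R[i]]_6.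

(* e_k for 1 <= k <= 6; [e R k] is 0 for any other k. *)
Definition e (R : realType) (k : nat) : IDD R := \row_j (j.+1 == k)%:R.

Definition basis_mul (R : realType) (i j : nat) : IDD R :=
  if (i + j <= 4)%N then (i.+1%:R * j.+1%:R)^-1 *: e R (i + j + 2) else 0.

Definition IDD_mul (R : realType) (a b : IDD R) : IDD R :=
  \sum_(i < 6) \sum_(j < 6) (a 0 i * b 0 j) *: basis_mul R i.+1 j.+1.

Definition extend_fun (R : realType) (f : nat -> IDD R) (a : IDD R) : IDD R :=
  \sum_(j < 6) a 0 j *: f j.+1.

Fact extend_fun_is_linear (R : realType) (f : nat -> IDD R) :
  linear (extend_fun f).
Proof.
move=> c a b; rewrite /extend_fun scaler_sumr -big_split /=.
by apply: eq_bigr => j _; rewrite !mxE scalerDl scalerA.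
Qed.

HB.instance Definition _ (R : realType) (f : nat -> IDD R) :=
  GRing.isLinear.Build R[i] (IDD R) (IDD R) _ (extend_fun f)
    (extend_fun_is_linear f).

(* The linear endomorphism with e_k |-> f k for 1 <= k <= 6. *)
Definition extend (R : realType) (f : nat -> IDD R) : 'End(IDD R) :=
  linfun (extend_fun f).

Definition varphi (R : realType) (i : nat) : 'End(IDD R) :=
  extend (fun k => match i, k with
    | 6%N, 1%N => e R 6
    | 5%N, 1%N => e R 5
    | 4%N, 1%N => e R 4
    | 3%N, 1%N => e R 3
    | 3%N, 4%N => e R 6
    | 2%N, 1%N => 3%:R *: e R 2
    | 2%N, 4%N => 4%:R *: e R 5
    | 2%N, 5%N => 2%:R *: e R 6
    | 1%N, 1%N => e R 1
    | 1%N, 3%N => - e R 3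
    | 1%N, 4%N => 2%:R *: e R 4
    | 1%N, 5%N => e R 5
    | _, _ => 0
    end).

Definition phi (R : realType) (j : nat) : 'End(IDD R) :=
  extend (fun k => match j, k with
    | 6%N, 2%N => e R 6
    | 5%N, 2%N => e R 5
    | 4%N, 2%N => e R 4
    | 3%N, 2%N => 4%:R *: e R 3
    | 3%N, 5%N => 3%:R *: e R 6
    | 2%N, 2%N => e R 2
    | 2%N, 3%N => 2%:R *: e R 3
    | 2%N, 5%N => e R 5
    | 2%N, 6%N => 2%:R *: e R 6
    | _, _ => 0
    end).

Definition psi (R : realType) (l : nat) : 'End(IDD R) :=
  extend (fun k => match l, k with
    | 6%N, 3%N => e R 6
    | 5%N, 3%N => e R 5
    | 4%N, 3%N => e R 4
    | _, _ => 0
    end).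

Definition der_generators (R : realType) : seq 'End(IDD R) :=
  [seq varphi R i | i <- [:: 1; 2; 3; 4; 5; 6]%N] ++
  [seq phi R j | j <- [:: 2; 3; 4; 5; 6]%N] ++
  [seq psi R k | k <- [:: 4; 5; 6]%N].

Lemma eE (R : realType) (k : 'I_6) : e R k.+1 = delta_mx 0 k.
Proof. by apply/rowP=> j; rewrite !mxE eqxx /= eqSS. Qed.

Lemma extendE (R : realType) (f : nat -> IDD R) (k : nat) :
  (1 <= k <= 6)%N -> extend f (e R k) = f k.
Proof.
case: k => [//|k] /= ltk6; rewrite lfunE /= /extend_fun.
rewrite (bigD1 (Ordinal ltk6)) //= big1 => [|j neqjk].
  by rewrite !mxE eqxx scale1r addr0.
rewrite mxE eqSS; case: eqP => [eqjk|_]; last by rewrite scale0r.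
by rewrite -val_eqE /= eqjk eqxx in neqjk.
Qed.

Lemma IDD_mul_e (R : realType) (i j : nat) :
  (1 <= i <= 6)%N -> (1 <= j <= 6)%N ->
  IDD_mul (e R i) (e R j) = basis_mul R i j.
Proof.
case: i j => [//|i] [//|j] /= lti6 ltj6; rewrite /IDD_mul.
rewrite (bigD1 (Ordinal lti6)) //= [X in _ + X]big1 => [|i' neqi].
  rewrite (bigD1 (Ordinal ltj6)) //= big1 => [|j' neqj].
    by rewrite !mxE !eqxx mulr1 scale1r !addr0.
  rewrite !mxE !eqSS; case: (j' =P j :> nat) => [eqj|_].
    by rewrite -val_eqE /= eqj eqxx in neqj.
  by rewrite mulr0 scale0r.
apply: big1 => j' _; rewrite !mxE !eqSS; case: (i' =P i :> nat) => [eqi|_].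
  by rewrite -val_eqE /= eqi eqxx in neqi.
by rewrite mul0r scale0r.
Qed.

(* Main.v *)
From HB Require Import structures.
Require Import Defs.
From mathcomp Require Import all_boot all_order all_algebra.
From mathcomp Require Import reals complex.
From mathcomp Require Import ring.

(** The algebra is commutative and generated by e_1, e_2, e_3: its only nonzero
    products of basis vectors are e_1 e_1 = e_4 / 4, e_1 e_2 = e_5 / 6,
    e_1 e_3 = e_6 / 8 and e_2 e_2 = e_6 / 9.  A derivation is therefore
    determined by the images of e_1, e_2, e_3 ([derivation_eq]).

    These images are constrained by the relations among the generators.  Let
    c_kl be the coefficient of e_l in D e_k.  Applying D to
    9 e_2 e_2 = 8 e_1 e_3 and to e_2 e_3 = 0 forces c_21 = c_31 = c_32 = 0 and
    c_33 = 2 c_22 - c_11 ([derivation_coefs]).  The free parameters that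
    remain, c_11, ..., c_16, c_22, ..., c_26, c_34, c_35, c_36, are exactly
    as many as the listed maps, and the combination of these maps with the same
    parameters (up to the factors 3 and 4 in varphi_2 and phi_3) agrees with D on e_1, e_2, e_3, hence is D
    ([derivation_in_span]).

    Conversely the Leibniz rule is bilinear in its two arguments, symmetric,
    and linear in D, so that it is enough to check it for each listed map on
    the pairs (e_i, e_j) with i <= j ([generator_derivation]). *)

Set Implicit Arguments.
Unset Strict Implicit.
Unset Printing Implicit Defensive.

Import GRing.Theory Num.Theory.

Local Open Scope ring_scope.

Section Derivations.
Variable R : realType.
Implicit Types (a b v : IDD R) (D : 'End(IDD R)).

(** * Bilinearity and commutativity of the product *)

Lemma IDD_mul_is_linear a : linear (IDD_mul a).
Proof.
move=> c b b'; rewrite /IDD_mul scaler_sumr -big_split; apply: eq_bigr => i _.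
rewrite scaler_sumr -big_split; apply: eq_bigr => j _.
by rewrite /= !mxE scalerA -scalerDl mulrDr mulrCA.
Qed.

HB.instance Definition _ a :=
  GRing.isLinear.Build R[i] (IDD R) (IDD R) _ (IDD_mul a)
    (IDD_mul_is_linear a).

(** Instances of the generic linearity lemmas with [IDD_mul] as a fixed head
    symbol: rewriting with the generic ones may unfold the product. *)
Lemma IDD_mulr0 a : IDD_mul a 0 = 0.
Proof. exact: linear0. Qed.

Lemma IDD_mulrN a b : IDD_mul a (- b) = - IDD_mul a b.
Proof. exact: linearN. Qed.

Lemma IDD_mulrZ c a b : IDD_mul a (c *: b) = c *: IDD_mul a b.
Proof. exact: linearZ. Qed.

Lemma IDD_mulrD a b b' : IDD_mul a (b + b') = IDD_mul a b + IDD_mul a b'.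
Proof. exact: linearD. Qed.

Lemma IDD_mulC : commutative (@IDD_mul R).
Proof.
move=> a b; rewrite /IDD_mul exchange_big; apply: eq_bigr => i _.
apply: eq_bigr => j _; rewrite (mulrC (a 0 j)); congr (_ *: _).
by rewrite /basis_mul addnC [X in X^-1]mulrC.
Qed.

(** * Coefficients and products in the basis *)

Lemma e_decomp a : a = \sum_(k < 6) a 0 k *: e R k.+1.
Proof.
by rewrite {1}(row_sum_delta a); apply: eq_bigr => k _; rewrite eE.
Qed.

(** Indexed from 1, like [e]. *)
Definition ecoef a (k : nat) : R[i] := a 0 (inord k.-1).

Lemma ecoefD a b k : ecoef (a + b) k = ecoef a k + ecoef b k.
Proof. exact: mxE. Qed.

Lemma ecoefZ c a k : ecoef (c *: a) k = c * ecoef a k.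
Proof. exact: mxE. Qed.

Lemma ecoef0 k : ecoef 0 k = 0.
Proof. exact: mxE. Qed.

Lemma ecoef_e k l : (1 <= l <= 6)%N -> ecoef (e R k) l = (l == k)%:R.
Proof. by case: l => // l l6; rewrite /ecoef mxE inordK. Qed.

Lemma e_expand a :
  a = ecoef a 1 *: e R 1 + ecoef a 2 *: e R 2 + ecoef a 3 *: e R 3
      + ecoef a 4 *: e R 4 + ecoef a 5 *: e R 5 + ecoef a 6 *: e R 6.
Proof.
rewrite {1}(e_decomp a) !big_ord_recr big_ord0 /= add0r.
by do !congr (_ + _); congr (_ *: _); congr (a 0 _); apply: val_inj;
  rewrite /= inordK.
Qed.

Lemma mul_e1 v :
  IDD_mul (e R 1) v
  = (ecoef v 1 / 4%:R) *: e R 4 + (ecoef v 2 / 6%:R) *: e R 5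
    + (ecoef v 3 / 8%:R) *: e R 6.
Proof.
rewrite {1}(e_expand v) !IDD_mulrD !IDD_mulrZ !IDD_mul_e // /basis_mul /=.
by rewrite !scaler0 !addr0 !scalerA -!natrM.
Qed.

Lemma mul_e2 v :
  IDD_mul (e R 2) v = (ecoef v 1 / 6%:R) *: e R 5 + (ecoef v 2 / 9%:R) *: e R 6.
Proof.
rewrite {1}(e_expand v) !IDD_mulrD !IDD_mulrZ !IDD_mul_e // /basis_mul /=.
by rewrite !scaler0 !addr0 !scalerA -!natrM.
Qed.

Lemma mul_e3 v : IDD_mul (e R 3) v = (ecoef v 1 / 8%:R) *: e R 6.
Proof.
rewrite {1}(e_expand v) !IDD_mulrD !IDD_mulrZ !IDD_mul_e // /basis_mul /=.
by rewrite !scaler0 !addr0 !scalerA -!natrM.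
Qed.

Lemma e4E : e R 4 = 4%:R *: IDD_mul (e R 1) (e R 1).
Proof.
by rewrite IDD_mul_e // /basis_mul /= scalerA -natrM divff ?scale1r ?pnatr_eq0.
Qed.

Lemma e5E : e R 5 = 6%:R *: IDD_mul (e R 1) (e R 2).
Proof.
by rewrite IDD_mul_e // /basis_mul /= scalerA -natrM divff ?scale1r ?pnatr_eq0.
Qed.

Lemma e6E13 : e R 6 = 8%:R *: IDD_mul (e R 1) (e R 3).
Proof.
by rewrite IDD_mul_e // /basis_mul /= scalerA -natrM divff ?scale1r ?pnatr_eq0.
Qed.

Lemma e6E22 : e R 6 = 9%:R *: IDD_mul (e R 2) (e R 2).
Proof.
by rewrite IDD_mul_e // /basis_mul /= scalerA -natrM divff ?scale1r ?pnatr_eq0.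
Qed.

Lemma mul_e2_e3 : IDD_mul (e R 2) (e R 3) = 0.
Proof. by rewrite IDD_mul_e. Qed.

(** * The Leibniz rule *)

Definition leibniz D a b :=
  D (IDD_mul a b) = IDD_mul (D a) b + IDD_mul a (D b).

Lemma leibnizC D a b : leibniz D a b -> leibniz D b a.
Proof.
rewrite /leibniz => Dab; rewrite IDD_mulC Dab addrC; congr (_ + _);
  exact: IDD_mulC.
Qed.

(** Both sides of the rule are linear in the second argument. *)
Lemma leibniz_ext D a b :
  (forall k, (1 <= k <= 6)%N -> leibniz D a (e R k)) -> leibniz D a b.
Proof.
move=> Dae; rewrite /leibniz (e_decomp b) (linear_sum (IDD_mul a)).
rewrite !linear_sum -big_split /=.
by apply: eq_bigr => k _; rewrite !linearZ /= Dae ?ltn_ord //= scalerDr.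
Qed.

Lemma derivation_basis D :
  (forall i j, (1 <= i <= j)%N -> (j <= 6)%N -> leibniz D (e R i) (e R j)) ->
  is_derivation (@IDD_mul R) D.
Proof.
move=> De a b; apply: leibniz_ext => j /andP[j1 j6].
apply: leibnizC; apply: leibniz_ext => i /andP[i1 i6].
by case: (leqP i j) => [ij|/ltnW ij]; [apply: leibnizC|]; apply: De;
  rewrite ?i1 ?j1.
Qed.

(** For fixed arguments the Leibniz rule is a linear condition on the map. *)
Lemma derivation_span (s : seq 'End(IDD R)) D :
  {in s, forall G, is_derivation (@IDD_mul R) G} ->
  D \in <<s>>%VS -> is_derivation (@IDD_mul R) D.
Proof.
move=> ders /(@coord_span _ _ _ (in_tuple s)) ->; apply: big_ind.
- by move=> a b; rewrite !lfunE /= IDD_mulr0 IDD_mulC IDD_mulr0 addr0.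
- move=> D1 D2 der1 der2 a b; rewrite !lfunE /= der1 der2 IDD_mulrD.
  by rewrite [IDD_mul (_ + _) b]IDD_mulC IDD_mulrD !(IDD_mulC b) addrACA.
move=> i _ a b; rewrite !lfunE /= (ders _ (mem_nth 0 (ltn_ord i))) scalerDr.
by rewrite IDD_mulrZ [IDD_mul (_ *: _) b]IDD_mulC IDD_mulrZ (IDD_mulC b).
Qed.

(** The vectors e_4, e_5, e_6 are multiples of products of e_1, e_2, e_3, so
    the Leibniz rule fixes their images. *)
Lemma derivation_eq D E :
  is_derivation (@IDD_mul R) D -> is_derivation (@IDD_mul R) E ->
  (forall k, (1 <= k <= 3)%N -> D (e R k) = E (e R k)) -> D = E.
Proof.
move=> derD derE DE; apply/lfunP => a; rewrite (e_decomp a) !linear_sum.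
apply: eq_bigr => k _; rewrite !linearZ /=; congr (_ *: _).
have lin (G : 'End(IDD R)) c b : G (c *: b) = c *: G b by exact: linearZ.
case: k => -[|[|[|[|[|[|k]]]]]] //= _; try exact: DE.
- by rewrite e4E !lin derD derE !DE.
- by rewrite e5E !lin derD derE !DE.
- by rewrite e6E13 !lin derD derE !DE.
Qed.

(** * The listed maps are derivations *)

(** Each listed map sends every basis vector to a multiple of a basis vector
    and shifts indices by a constant, so that the Leibniz rule on a pair of
    basis vectors is an equation between two multiples of the same vector. *)
Lemma generator_derivation D :
  D \in der_generators R -> is_derivation (@IDD_mul R) D.
Proof.
move=> Dgen; apply: derivation_basis => i j /andP[i1 ij] j6.
have lin c b : D (c *: b) = c *: D b by exact: linearZ.
rewrite /leibniz IDD_mul_e; last 2 first.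
- by rewrite i1 (leq_trans ij).
- by rewrite (leq_trans i1).
rewrite (IDD_mulC _ (e R j)).
move: i1 ij; do 7?[case: j j6 => [|j] j6] => //.
all: do 7?[case: i => [|i]] => // _ _.
all: rewrite /basis_mul /= ?(linear0 D) ?lin.
all: rewrite !inE in Dgen; repeat (case/orP: Dgen => [Dgen|Dgen]).
all: move/eqP: Dgen (lin) => -> {}lin.
all: rewrite !extendE //= ?IDD_mulrN ?IDD_mulrZ ?IDD_mulr0 ?IDD_mul_e //.
all: rewrite /basis_mul /= ?scaler0 ?oppr0 ?addr0 ?add0r.
all: rewrite ?scalerN ?scalerA -?scalerBl -?scalerDl -?scaleNr //.
(* The second alternative is for the image of e_6 under varphi_1, where the two
   terms on the right cancel. *)
all: first [ congr (_ *: _); field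
           | rewrite -[LHS](scale0r (e R 6)); congr (_ *: _); field ].
all: by rewrite ?pnatr_eq0.
Qed.

(** * Every derivation is a combination of the listed maps *)

Lemma derivation_coefs D (c := fun k => ecoef (D (e R k))) :
  is_derivation (@IDD_mul R) D ->
  [/\ c 2%N 1%N = 0, c 3%N 1%N = 0, c 3%N 2%N = 0
    & c 3%N 3%N = 2%:R * c 2%N 2%N - c 1%N 1%N].
Proof.
move=> derD.
have lin x b : D (x *: b) = x *: D b by exact: linearZ.
have e6D : 9%:R *: D (IDD_mul (e R 2) (e R 2))
           = 8%:R *: D (IDD_mul (e R 1) (e R 3)).
  by rewrite -!lin -e6E13 -e6E22.
have e23D : D (IDD_mul (e R 2) (e R 3)) = 0 by rewrite mul_e2_e3 linear0.
move: e6D e23D; rewrite !derD.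
rewrite !(IDD_mulC _ (e R 2)) !(IDD_mulC _ (e R 3)) mul_e1 !mul_e2 !mul_e3.
rewrite -!/(c _ _) => e6D e23D.
have E k := congr1 (fun v : IDD R => ecoef v k) e6D.
have E' k := congr1 (fun v : IDD R => ecoef v k) e23D.
move: (E 4%N) (E 5%N) (E 6%N) (E' 6%N) => {E E'}.
rewrite !(ecoefD, ecoefZ) ecoef0 !ecoef_e //=.
move: (c 1%N 1%N) (c 2%N 1%N) (c 2%N 2%N) (c 3%N 1%N) (c 3%N 2%N) (c 3%N 3%N).
move=> c11 c21 c22 c31 c32 c33.
rewrite !(mulr0, mulr1, addr0, add0r) => E4 E5 E6 E6'.
have nz n : n.+1%:R != 0 :> R[i] by rewrite pnatr_eq0.
have c21_0 : c21 = 0.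
  (* E5 and E6' are two independent linear equations in c21 and c32; the
     multipliers 8/3 and 2/9 eliminate c32 and normalize c21. *)
  transitivity (8%:R / 3%:R * (c21 / 8%:R + c32 / 9%:R)
    + 2%:R / 9%:R * (9%:R * (c21 / 6%:R + c21 / 6%:R) - 8%:R * (c32 / 6%:R))).
    by field; rewrite ?nz.
  by rewrite E6' E5 subrr !mulr0 addr0.
split=> {e6D e23D} //.
- transitivity (8%:R * (c31 / 4%:R) / 2%:R); first by field; rewrite ?nz.
  by rewrite -E4 mul0r.
- transitivity (9%:R * (c21 / 8%:R + c32 / 9%:R) - 9%:R / 8%:R * c21).
    by field; rewrite ?nz.
  by rewrite E6' c21_0 !mulr0 subrr.
- transitivity (8%:R * (c11 / 8%:R + c33 / 8%:R) - c11).
    by field; rewrite ?nz.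
  by rewrite -E6; field; rewrite ?nz.
Qed.

Lemma derivation_in_span D :
  is_derivation (@IDD_mul R) D -> D \in <<der_generators R>>%VS.
Proof.
move=> derD; have [c21 c31 c32 c33] := derivation_coefs derD.
pose c k := ecoef (D (e R k)).
(* The divisors 3 and 4 undo the normalization of varphi_2 and phi_3:
   varphi_2 e_1 = 3 e_2 and phi_3 e_2 = 4 e_3. *)
pose x k := c 1%N k / (if k == 2%N then 3%:R else 1).
pose y k := c 2%N k / (if k == 3%N then 4%:R else 1).
pose E : 'End(IDD R) :=
  \sum_(k <- [:: 1; 2; 3; 4; 5; 6]%N) x k *: varphi R k
  + (\sum_(k <- [:: 2; 3; 4; 5; 6]%N) y k *: phi R k
     + \sum_(k <- [:: 4; 5; 6]%N) c 3%N k *: psi R k).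
have Espan : E \in <<der_generators R>>%VS.
  apply: memvD; last apply: memvD; rewrite big_seq; apply: memv_suml => k kgen;
    apply/memvZ/memv_span; rewrite !mem_cat.
  - by rewrite (map_f (varphi R)).
  - by rewrite (map_f (phi R)) ?orbT.
  - by rewrite (map_f (psi R)) ?orbT.
suff -> : D = E by [].
apply: derivation_eq => //.
  by apply: derivation_span Espan; exact: generator_derivation.
have Ee k : E (e R k) =
    \sum_(i <- [:: 1; 2; 3; 4; 5; 6]%N) x i *: varphi R i (e R k)
  + (\sum_(i <- [:: 2; 3; 4; 5; 6]%N) y i *: phi R i (e R k)
     + \sum_(i <- [:: 4; 5; 6]%N) c 3%N i *: psi R i (e R k)).
  rewrite add_lfunE add_lfunE !sum_lfunE.
  by do ![congr (_ + _)]; apply: eq_bigr => i _; rewrite scale_lfunE.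
move=> k k13.
have k16 : (1 <= k <= 6)%N by case/andP: k13 => -> /leq_trans ->.
rewrite [LHS]e_expand -!/(c _ _) Ee.
under [X in _ = X + _]eq_bigr do rewrite extendE //.
under [X in _ = _ + (X + _)]eq_bigr do rewrite extendE //.
under [X in _ = _ + (_ + X)]eq_bigr do rewrite extendE //.
rewrite !big_cons !big_nil /x /y.
case: k k13 {k16} => [|[|[|[|k]]]] //= _; rewrite !scaler0 !addr0 ?add0r ?divr1.
- by rewrite scalerA divfK ?pnatr_eq0 // !addrA.
- by rewrite [c 2%N 1%N]c21 scale0r add0r scalerA divfK ?pnatr_eq0 // !addrA.
- rewrite [c 3%N 1%N]c31 [c 3%N 2%N]c32 [c 3%N 3%N]c33 !scale0r !add0r.
  rewrite scalerN scalerA (mulrC _ 2%:R) addrA -scaleNr -scalerDl.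
  by rewrite (addrC (- _)) !addrA.
Qed.

End Derivations.

Unset Implicit Arguments.

Theorem proposition4p23 (R : realType) (D : 'End(IDD R)) :
  is_derivation (@IDD_mul R) D <-> D \in <<der_generators R>>%VS.
Proof.
split; first exact: derivation_in_span.
by apply: derivation_span; exact: generator_derivation.
Qed.
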